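(* Let $(J,\langle\cdot,\cdot\rangle)$ be an almost Hermitian structure on a $2n$-dimensional almost abelian Lie algebra $\mathfrak{g}=\mathbb{R}e_0\ltimes_L\mathbb{R}^{2n-1}$, with associated data $\mu$, $\gamma$, $\rho$, $D_s$, $D_a$, $S$, $J'$ as defined in the context. Then $J$ is harmonic, i.e. $[J,\nabla^*\nabla J]=0$, if and only if the following two conditions are satisfied: (i) $\mu\gamma+D_s\gamma-(\operatorname{Tr} S)\rho-J'D_aJ'\rho=0$; (ii) $D_aJ'D_aJ'-J'D_aJ'D_a+(\operatorname{Tr} S)[D_a,J']J'=0$.
   Context: A Lie algebra $\mathfrak{g}$ is almost abelian if it has a codimension one abelian ideal $\mathfrak{u}$. An almost Hermitian structure on a real Lie algebra $\mathfrak g$ is a pair $(J,\langle\cdot,\cdot\rangle)$ with $\langle\cdot,\cdot\rangle$ an inner product and $J:\mathfrak{g}\to\mathfrak{g}$ an endomorphism with $J^2=-\mathrm{I}$ and $\langle J\cdot,J\cdot\rangle=\langle\cdot,\cdot\rangle$. Levi-Civita connection: the bilinear map $\nabla:\mathfrak g\times\mathfrak g\to\mathfrak g$ given by $2\langle\nabla_XY,Z\rangle=\langle[X,Y],Z\rangle-\langle[Y,Z],X\rangle+\langle[Z,X],Y\rangle$. The rough Laplacian of $J$ is the endomorphism $(\nabla^*\nabla J)(X)=\sum_i(\nabla^2_{f_i,f_i}J)(X)$ for any orthonormal basis $\{f_i\}$ of $\mathfrak g$, where $(\nabla^2_{U,V}J)(W)=(\nabla_U(\nabla_VJ))(W)-(\nabla_{\nabla_UV}J)(W)$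 and, for an endomorphism $T$, $(\nabla_UT)(W)=\nabla_U(TW)-T\nabla_UW$. $J$ is called harmonic if $[J,\nabla^*\nabla J]=0$ on $\mathfrak g$ (commutator of endomorphisms). Notation for a $2n$-dimensional almost abelian $\mathfrak g$ with almost Hermitian structure: fix a codimension one abelian ideal $\mathfrak u$ and a unit vector $e_0$ orthogonal to $\mathfrak u$, and let $L=\operatorname{ad}_{e_0}|_{\mathfrak u}$, so $\mathfrak g=\mathbb{R}e_0\ltimes_L\mathfrak u$, $\mathfrak u\cong\mathbb{R}^{2n-1}$. Put $e_1=Je_0\in\mathfrak u$, let $\mathfrak a=\mathfrak u\cap J\mathfrak u$ (of dimension $2n-2$, the orthogonal complement of $\mathrm{span}\{e_0,e_1\}$), and $J'=J|_{\mathfrak a}$. With respect to the orthogonal decomposition $\mathfrak u=\mathbb{R}e_1\oplus\mathfrak a$ write $$L=\begin{bmatrix}\mu & w_0^t\\ v_0 & D\end{bmatrix},\qquad \mu\in\mathbb R,\ v_0,w_0\in\mathfrak a,\ D\in\mathfrak{gl}(\mathfrak a),$$ that is, $Le_1=\mu e_1+v_0$ and $Lx=\langle w_0,x\rangle e_1+Dx$ for $x\in\mathfrak a$. Let $S=\frac12(L+L^t)$ be the symmetric part of $L$, $D_s=\frac12(D+D^t)$ and $D_a=\frac12(D-D^t)$ the symmetric and skew-symmetric parts of $D$, and $\gamma=\frac12(v_0+w_0)$, $\rho=\frac12(v_0-w_0)$. *)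

(* Defs.v *)
From HB Require Import structures.
From mathcomp Require Import all_boot all_order all_algebra.
From mathcomp Require Import reals ring.

Set Implicit Arguments.
Unset Strict Implicit.
Unset Printing Implicit Defensive.
Import Order.TTheory GRing.Theory Num.Theory.
Local Open Scope ring_scope.

(* A real inner product is a dot product whose conjugation is the identity. *)
Notation "{ 'inner' V }" := {dot V for idfun} (format "{ 'inner'  V }").

Section InnerProduct.
Variables (R : realType) (V : vectType R).

Lemma innerC (ip : {inner V}) x y : ip x y = ip y x.
Proof. by rewrite hermC /= expr0 mul1r. Qed.

Lemma innerPl (ip : {inner V}) a x y z :
  ip (a *: x + y) z = a * ip x z + ip y z.
Proof. exact: linearPl. Qed.

Lemma innerPr (ip : {inner V}) a x y z :
  ip z (a *: x + y) = a * ip z x + ip z y.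
Proof. by rewrite innerC innerPl !(innerC _ z). Qed.

Lemma innerZl (ip : {inner V}) a x z : ip (a *: x) z = a * ip x z.
Proof. exact: linearZl_LR. Qed.

Definition orthonormal_basis (ip : {inner V}) (f : seq V) : bool :=
  basis_of fullv f && orthonormal ip f.

Definition gram (ip : V -> V -> R) : 'M[R]_(\dim {:V}) :=
  \matrix_(i, j) ip (vbasis {:V})`_i (vbasis {:V})`_j.

(* The vector representing the linear form [phi], see [rieszE]. *)
Definition riesz (ip : V -> V -> R) (phi : V -> R) : V :=
  passmx.vecof (vbasis {:V})
    ((\row_i phi (vbasis {:V})`_i) *m invmx (gram ip)).

Lemma ip_suml (ip : {inner V}) n (F : 'I_n -> V) (c : 'I_n -> R) y :
  ip (\sum_i c i *: F i) y = \sum_i c i * ip (F i) y.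
Proof. rewrite linear_sumlz; by apply: eq_bigr => i _; apply: innerZl. Qed.

Lemma gram_unit (ip : {inner V}) : gram ip \in unitmx.
Proof.
rewrite -row_free_unit -kermx_eq0; apply/eqP/row_matrixP => i.
rewrite row0; set c := row i _.
have c0 : c *m gram ip = 0 by apply/sub_kermxP; rewrite row_sub.
pose v := passmx.vecof (vbasis {:V}) c.
have ipv (j : 'I_(\dim {:V})) : ip v (vbasis {:V})`_j = 0.
  have := congr1 (fun M : 'rV_(\dim {:V}) => M 0 j) c0.
  rewrite mxE [X in _ = X]mxE => <-; rewrite /v /passmx.vecof ip_suml.
  by apply: eq_bigr => k _; rewrite [gram _ _ _]mxE.
apply/eqP; rewrite -(passmx.vecof_eq0 (vbasisP {:V})) -/v.
apply/negPn/negP => /(neq0_dnorm_gt0 (s:=ip)).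
rewrite [X in ip X _](_ : v = \sum_k c 0 k *: (vbasis {:V})`_k) //.
rewrite ip_suml big1 ?ltxx // => k _.
by rewrite innerC ipv mulr0.
Qed.

Lemma rieszE (ip : {inner V}) (phi : {scalar V}) x :
  ip (riesz ip phi) x = phi x.
Proof.
have eb (j : 'I_(\dim {:V})) :
    ip (riesz ip phi) (vbasis {:V})`_j = phi (vbasis {:V})`_j.
  rewrite /riesz /passmx.vecof; set c := _ *m _; rewrite ip_suml.
  have : (c *m gram ip) 0 j = phi (vbasis {:V})`_j.
    by rewrite mulmxKV ?gram_unit // mxE.
  by rewrite mxE => <-; apply: eq_bigr => k _; rewrite [gram _ _ _]mxE.
rewrite (coord_vbasis (memvf x)) innerC ip_suml linear_sum.
by apply: eq_bigr => j _; rewrite linearZ innerC eb.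
Qed.

Definition adjoint (ip : V -> V -> R) (f : 'End(V)) : 'End(V) :=
  linfun (fun y => riesz ip (fun x => ip (f x) y)).

Lemma riesz_linear (ip : V -> V -> R) (a : R) (phi psi : V -> R) :
  riesz ip (fun x => a * phi x + psi x) = a *: riesz ip phi + riesz ip psi.
Proof.
rewrite /riesz -passmx.vecof_linear scalemxAl -mulmxDl; congr (passmx.vecof _ (_ *m _)).
by apply/rowP => i; rewrite !mxE.
Qed.

Lemma adjointE (ip : {inner V}) (f : 'End(V)) x y :
  ip x (adjoint ip f y) = ip (f x) y.
Proof.
have lin : linear (fun y => riesz ip (fun x => ip (f x) y)).
  move=> a u v; rewrite -riesz_linear /riesz; congr (passmx.vecof _ (_ *m _)).
  by apply/rowP => i; rewrite !mxE innerPr.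
pose Q := GRing.isLinear.Build _ _ _ _ _ lin.
pose q : {linear V -> V} := HB.pack (fun y => riesz ip (fun x => ip (f x) y)) Q.
rewrite innerC /adjoint (lfunE q) /=.
have lin1 : scalar (fun x => ip (f x) y).
  by move=> a u v; rewrite linearP innerPl.
pose P1 := GRing.isLinear.Build _ _ _ _ _ lin1.
pose p1 : {scalar V} := HB.pack (fun x => ip (f x) y) P1.
exact: (rieszE ip p1).
Qed.

Definition sym_part (ip : V -> V -> R) (f : 'End(V)) : 'End(V) :=
  2^-1 *: (f + adjoint ip f).
Definition skew_part (ip : V -> V -> R) (f : 'End(V)) : 'End(V) :=
  2^-1 *: (f - adjoint ip f).

(* The trace, computed in a basis of [V]; it does not depend on the basis. *)
Definition lfun_tr (f : 'End(V)) : R :=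
  \tr (passmx.mxof (vbasis {:V}) (vbasis {:V}) f).

Definition lfun_comm (f g : 'End(V)) : 'End(V) := ((f \o g) - (g \o f))%VF.

End InnerProduct.

Section Restriction.
Variables (R : realType) (V : vectType R) (ip : {inner V}) (U : {vspace V}).

Definition sub_ip (x y : subvs_of U) : R := ip (vsval x) (vsval y).

Lemma sub_ip_bilinear :
  bilinear_for *%R (idfun \; *%R) (sub_ip : _ -> _ -> R).
Proof.
split=> [y a u v|x a u v]; rewrite /sub_ip /applyr linearP.
  by rewrite innerPl.
by [].
Qed.

HB.instance Definition _ :=
  bilinear_isBilinear.Build _ _ _ _ _ _ sub_ip sub_ip_bilinear.

Lemma sub_ip_sym x y : sub_ip x y = (-1) ^+ false * idfun (sub_ip y x).
Proof. by rewrite expr0 mul1r /sub_ip innerC. Qed.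

HB.instance Definition _ :=
  isHermitianSesquilinear.Build _ _ _ _ sub_ip sub_ip_sym.

Lemma sub_ip_gt0 x : x != 0 -> 0 < sub_ip x x.
Proof.
move=> x0; apply: neq0_dnorm_gt0; apply: contra x0 => /eqP x0.
by apply/eqP/val_inj.
Qed.

HB.instance Definition _ := isDotProduct.Build _ _ sub_ip sub_ip_gt0.

End Restriction.

Section AlmostAbelian.
Variables (R : realType) (g : vectType R).
Implicit Types (br : {bilinear g -> g -> g}) (ip : {inner g}) (J : 'End(g)).
Implicit Types (u : {vspace g}) (T : g -> g).

Definition is_lie_bracket br : Prop :=
  (forall x, br x x = 0) /\
  (forall x y z, br x (br y z) + br y (br z x) + br z (br x y) = 0).

Definition abelian_ideal br u : Prop :=
  (forall x y, y \in u -> br x y \in u) /\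
  (forall x y, x \in u -> y \in u -> br x y = 0).

Definition codim_one u : Prop := (\dim u).+1 = \dim {:g}.

Definition almost_hermitian ip J : Prop :=
  (J \o J)%VF = - \1%VF /\ isometry ip ip J.

Definition levi_civita br ip (X Y : g) : g :=
  riesz ip (fun Z => 2^-1 * (ip (br X Y) Z - ip (br Y Z) X + ip (br Z X) Y)).

Lemma koszul br ip X Y Z :
  2 * ip (levi_civita br ip X Y) Z =
  ip (br X Y) Z - ip (br Y Z) X + ip (br Z X) Y.
Proof.
pose p Z := 2^-1 * (ip (br X Y) Z - ip (br Y Z) X + ip (br Z X) Y).
have lin : scalar p.
  move=> a U W; rewrite /p innerPr.
  rewrite (linearPr br) (linearPl br) /= !innerPl /=; by ring.
pose P := GRing.isLinear.Build _ _ _ _ p lin.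
pose q : {scalar g} := HB.pack p P.
by rewrite [ip _ Z](rieszE ip q) /= /p mulrA divff ?mul1r // pnatr_eq0.
Qed.

(* Covariant derivative of an endomorphism in the direction [X]. *)
Definition cov_end br ip (X : g) T (W : g) : g :=
  levi_civita br ip X (T W) - T (levi_civita br ip X W).

Definition cov2_end br ip (X Y : g) T (W : g) : g :=
  cov_end br ip X (cov_end br ip Y T) W
  - cov_end br ip (levi_civita br ip X Y) T W.

Definition rough_laplacian br ip (f : seq g) T (W : g) : g :=
  \sum_(e <- f) cov2_end br ip e e T W.

(* [J] commutes with its rough Laplacian; [f] is meant to be an orthonormal
   basis, and the notion does not depend on which one. *)
Definition harmonic br ip (f : seq g) J : Prop :=
  forall W, J (rough_laplacian br ip f J W)
            - rough_laplacian br ip f J (J W) = 0.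

(* The largest [J]-invariant subspace of [u], u \cap Ju. *)
Definition J_inv_part J u : {vspace g} := (u :&: (J @: u))%VS.

End AlmostAbelian.

(* Main.v *)
(** With [S] and [A] the symmetric and skew parts of [ad e0], the Levi-Civita
    connection is [nabla_X Y = <e0,X> A Y + <S X,Y> e0 - <e0,Y> S X]. As each
    [nabla_X] is an endomorphism, [J^2 = -1] turns the commutator of [J] with
    its rough Laplacian into twice
      [C = (A J A J - J A J A) + (P J - J P) - Tr S (A + J A J)],
    where [P Y = <S Y,S e1> e0 - <e0,Y> S^2 e1] collects the contribution of
    [u]. Along [g = R e0 + R e1 + a], writing [c1] and [c2] for the left-hand
    sides of (i) and (ii), one finds [C e1 = c1] and, for [x] in [a],
    [C x = <c1,J'x> e0 - <c1,x> e1 + c2 x]; since [C] anticommutes with [J],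
    this determines [C e0] too. *)

Require Import Defs.
From HB Require Import structures.
From mathcomp Require Import all_boot all_order all_algebra.
From mathcomp Require Import reals ring.

Set Implicit Arguments.
Unset Strict Implicit.
Unset Printing Implicit Defensive.
Import Order.TTheory GRing.Theory Num.Theory.
Local Open Scope ring_scope.

(** * Inner products: nondegeneracy, orthonormal expansions and traces *)

Section InnerProductTheory.
Variables (R : realType) (V : vectType R) (ip : {inner V}).
Implicit Types (x y z : V) (s : seq V).

Lemma innerDl x y z : ip (x + y) z = ip x z + ip y z.
Proof. by have := innerPl ip 1 x y z; rewrite scale1r mul1r. Qed.

Lemma inner0l x : ip 0 x = 0.
Proof. by rewrite -(scale0r 0) innerZl mul0r. Qed.

Lemma innerNl x y : ip (- x) y = - ip x y.
Proof. by rewrite -scaleN1r innerZl mulN1r. Qed.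

Lemma innerZr a x y : ip x (a *: y) = a * ip x y.
Proof. by rewrite innerC innerZl innerC. Qed.

Lemma innerDr x y z : ip z (x + y) = ip z x + ip z y.
Proof. by rewrite !(innerC _ z) innerDl. Qed.

Lemma inner0r x : ip x 0 = 0.
Proof. by rewrite innerC inner0l. Qed.

Lemma innerNr x y : ip x (- y) = - ip x y.
Proof. by rewrite !(innerC _ x) innerNl. Qed.

Definition innerE :=
  (innerDl, innerDr, innerNl, innerNr, innerZl, innerZr, inner0l, inner0r).

Lemma inner_sumr (I : Type) (r : seq I) (F : I -> V) x :
  ip x (\sum_(i <- r) F i) = \sum_(i <- r) ip x (F i).
Proof.
by elim: r => [|i r IH]; rewrite ?big_nil ?inner0r // !big_cons innerDr IH.
Qed.

(** Nondegeneracy, used throughout to turn an identity between vectors into a scalar identity that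
    [ring] can settle. *)
Lemma inner_inj x y : (forall z, ip x z = ip y z) -> x = y.
Proof.
move=> xy; apply/subr0_eq/eqP/negPn/negP => /(neq0_dnorm_gt0 (s:=ip)).
by rewrite [ip _ _]innerDl innerNl xy subrr ltxx.
Qed.

Lemma orthonormal_expansion s x :
  orthonormal ip s -> x \in <<s>>%VS -> \sum_(e <- s) ip e x *: e = x.
Proof.
elim: s x => [|e s IH] x.
  by move=> _; rewrite span_nil memv0 big_nil => /eqP.
rewrite /orthonormal /= => /andP[/andP[/eqP ee s1] /andP[/andP[/allP es _] ss]].
have s_on : orthonormal ip s by rewrite /orthonormal s1.
rewrite span_cons => /memv_addP[_ /vlineP[a ->] [y ys ->]].
have eys (v : V) : v \in <<s>>%VS -> ip e v = 0.
  move=> vs; rewrite (coord_span (X:=in_tuple s) vs) inner_sumr big1 // => i _.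
  by rewrite innerZr; have /eqP -> := es _ (mem_nth 0 (ltn_ord i)); rewrite mulr0.
rewrite big_cons !innerE ee eys // mulr1 addr0; congr (_ + _).
rewrite -[RHS](IH y s_on ys); apply: eq_big_seq => v vs.
by rewrite !innerE (innerC ip v e) (eys v (memv_span vs)) mulr0 add0r.
Qed.

Section Parseval.
Variable s : seq V.
Hypothesis s_basis : orthonormal_basis ip s.

Lemma parseval_linear (W : lmodType R) (F : {linear V -> W}) x :
  \sum_(e <- s) ip e x *: F e = F x.
Proof.
have /andP[/andP[/eqP sV _] son] := s_basis.
rewrite -[in RHS](orthonormal_expansion son (_ : x \in _)) ?sV ?memvf //.
by rewrite linear_sum; apply: eq_bigr => e _; rewrite linearZ.
Qed.

Lemma parseval x y : \sum_(e <- s) ip e x * ip e y = ip x y.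
Proof.
have /andP[/andP[/eqP sV _] son] := s_basis.
rewrite -[in RHS](orthonormal_expansion son (_ : y \in _)) ?sV ?memvf //.
by rewrite inner_sumr; apply: eq_bigr => e _; rewrite innerZr innerC mulrC.
Qed.

(** Cyclicity of the trace: tr (i f p) = tr (f p i) = tr f, as p i = 1. A trace on a subspace thus
    becomes a sum over an orthonormal basis of the ambient space. *)
Lemma lfun_tr_orthonormal (U : vectType R) (i : {linear U -> V})
    (p : {linear V -> U}) (f : 'End(U)) :
  cancel i p -> lfun_tr f = \sum_(e <- s) ip e (i (f (p e))).
Proof.
move=> iK; pose b := vbasis {:U}.
transitivity (\sum_k coord b k (f b`_k)).
  rewrite /lfun_tr /mxtrace; apply: eq_bigr => k _.
  by rewrite /passmx.mxof mxE /= passmx.vecof_delta mxE.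
have expand (e : V) :
    ip e (i (f (p e))) = \sum_k coord b k (p e) * ip e (i (f b`_k)).
  rewrite {1}(coord_vbasis (memvf (p e))) !linear_sum.
  by apply: eq_bigr => k _; rewrite !linearZ.
rewrite (eq_bigr _ (fun e _ => expand e)) exchange_big; apply: eq_bigr => k _.
rewrite -{1}[f _]iK -(parseval_linear p) linear_sum.
by apply: eq_bigr => e _; rewrite linearZ mulrC.
Qed.

End Parseval.

End InnerProductTheory.

(** * The commutator of [J] with its rough Laplacian *)

Section HarmonicEquation.
Variables (R : realType) (g : vectType R) (br : {bilinear g -> g -> g}).
Variables (ip : {inner g}) (J A S : 'End(g)) (e0 : g) (s : seq g).
Hypothesis s_basis : orthonormal_basis ip s.
Hypothesis JJ : forall x, J (J x) = - x.
Hypothesis J_isom : forall x y, ip (J x) (J y) = ip x y.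
Hypothesis e0_unit : ip e0 e0 = 1.
Hypothesis S_sym : forall x y, ip (S x) y = ip x (S y).
Hypothesis Se0 : S e0 = 0.
Hypothesis Ae0 : A e0 = 0.
Hypothesis nablaE : forall X Y, levi_civita br ip X Y =
  ip e0 X *: A Y + ip (S X) Y *: e0 - ip e0 Y *: S X.

Let trS := \sum_(e <- s) ip e (S e).
Let nabla := levi_civita br ip.

Lemma J_skew x y : ip (J x) y = - ip x (J y).
Proof. by rewrite -(J_isom x) JJ innerNr opprK. Qed.

Lemma inner_Jr x : ip x (J x) = 0.
Proof.
have := J_skew x x; rewrite innerC => /eqP.
by rewrite -subr_eq0 opprK -mulr2n mulrn_eq0 /= => /eqP.
Qed.

Lemma nabla_is_linear X : linear (nabla X).
Proof.
move=> a U W; apply: (inner_inj (ip := ip)) => Z.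
by rewrite /nabla !nablaE !linearP /= !innerE; ring.
Qed.

(** The terms in [A e] and [S e] carry a factor <e0,e>, so they sum to [A e0] and [S e0], which
    vanish. What remains is the mean curvature vector of the hyperplane orthogonal to [e0]. *)
Lemma sum_nabla : \sum_(e <- s) nabla e e = trS *: e0.
Proof.
under eq_bigr => e _ do rewrite /nabla nablaE.
rewrite big_split big_split /= sumrN.
have tsum (F : 'End(g)) : \sum_(e <- s) ip e0 e *: F e = F e0.
  by under eq_bigr => e _ do rewrite innerC; rewrite (parseval_linear s_basis).
rewrite !tsum Ae0 Se0 add0r subr0 -scaler_suml.
by congr (_ *: _); apply: eq_bigr => e _; rewrite S_sym.
Qed.

(** The operator [P] of the overview. It is the sum over the basis of B_e J B_e, where B_e Y = <S
    e,Y> e0 - <e0,Y> S e. *)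
Definition second_fundamental_sq Y :=
  ip (S Y) (S (J e0)) *: e0 - ip e0 Y *: S (S (J e0)).

(** Here nabla_e = <e0,e> A + B_e, with B_e linear in [S e]. The pure terms give A J A and [P]; each
    mixed term is linear in both <e,e0> and [S e], so its sum has a factor [S e0] = 0. *)
Lemma sum_nabla_J_nabla Y :
  \sum_(e <- s) nabla e (J (nabla e Y)) = A (J (A Y)) + second_fundamental_sq Y.
Proof.
have term (e : g) : nabla e (J (nabla e Y)) =
  (ip e e0 * ip e e0) *: A (J (A Y))
  + (ip e e0 * ip e (S Y)) *: A (J e0)
  + - (ip e0 Y *: (ip e e0 *: A (J (S e))))
  + (ip e e0 * ip e (S (J (A Y)))) *: e0
  + (ip e (S Y) * ip e (S (J e0))) *: e0
  + - (ip e0 (J (A Y)) *: (ip e e0 *: S e))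
  + - (ip e0 Y *: (ip e (S (J e0)) *: S e)).
  have JSe : ip e0 (J (S e)) = - ip e (S (J e0)).
    by rewrite -S_sym innerC J_skew.
  apply: (inner_inj (ip := ip)) => Z.
  rewrite /nabla !nablaE !linearD !linearN !linearZ /= !innerE.
  rewrite !inner_Jr !JSe (S_sym e Y) (S_sym e (J (A Y))) (S_sym e (J e0)).
  rewrite (innerC ip e e0); ring.
under eq_bigr => e _ do rewrite term.
rewrite !big_split /= !sumrN -!scaler_sumr -!scaler_suml !(parseval s_basis).
have AJS0 : \sum_(e <- s) ip e e0 *: A (J (S e)) = 0.
  (* The composite is presented as one linear map so that the orthonormal expansion of [e0]
     applies. *)
  transitivity (\sum_(e <- s) ip e e0 *: (A \o (J \o S))%VF e).
    by apply: eq_bigr => e _; rewrite !comp_lfunE.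
  by rewrite (parseval_linear s_basis) /= !comp_lfunE Se0 !linear0.
rewrite AJS0 !(parseval_linear s_basis) e0_unit scale1r /= Se0.
rewrite -(S_sym e0 Y) -(S_sym e0 (J _)) Se0 !inner0l !scale0r !scaler0.
by rewrite !oppr0 !addr0 addrA.
Qed.

(** The second derivative N N J - 2 N J N + J N N, with N = N_e, has a commutator with [J] in which
    J N N J and N N cancel, leaving twice N J N J - J N J N. The first-order part N_h J - J N_h
    contributes twice N_h + J N_h J. *)
Lemma cov2_commutator (N : g -> g -> g) e h W :
    (forall X, {morph N X : x y / x - y}) ->
  let cov X T Y := N X (T Y) - T (N X Y) in
  let cov2 Y := cov e (cov e J) Y - cov h J Y in
  J (cov2 W) - cov2 (J W) =
  2 *: (N e (J (N e (J W))) - J (N e (J (N e W)))) - 2 *: (N h W + J (N h (J W))).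
Proof.
move=> NB; have NN X : {morph N X : x / - x}.
  by move=> x; rewrite -[- x]sub0r NB -[X in N _ X](subrr 0) NB subrr sub0r.
rewrite /= !JJ !NB !NN !linearB /= !JJ.
by apply: (inner_inj (ip := ip)) => Z; rewrite !innerE; ring.
Qed.

Lemma laplacian_commutator W :
  J (rough_laplacian br ip s J W) - rough_laplacian br ip s J (J W) =
  2 *: (A (J (A (J W))) - J (A (J (A W)))
        + (second_fundamental_sq (J W) - J (second_fundamental_sq W))
        - trS *: (A W + J (A (J W)))).
Proof.
have nB e x y : nabla e (x - y) = nabla e x - nabla e y.
  by rewrite addrC -scaleN1r nabla_is_linear scaleN1r addrC.
have term e : J (cov2_end br ip e e J W) - cov2_end br ip e e J (J W) =
  2 *: (nabla e (J (nabla e (J W))) - J (nabla e (J (nabla e W))))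
  - 2 *: (nabla (nabla e e) W + J (nabla (nabla e e) (J W))).
  exact: (cov2_commutator e (nabla e e) W nB).
(* Additivity in the direction reduces the sum to the derivative along [trS *: e0], where only [A]
   survives because [S e0] = 0. *)
have nsum x : \sum_(e <- s) nabla (nabla e e) x = trS *: A x.
  transitivity (nabla (\sum_(e <- s) nabla e e) x); last first.
    rewrite sum_nabla /nabla nablaE innerZr e0_unit mulr1 linearZ /= Se0.
    by rewrite scaler0 inner0l scale0r scaler0 addr0 subr0.
  have nabla0 y : nabla 0 y = 0.
    by rewrite /nabla nablaE inner0r linear0 inner0l !scale0r scaler0 addr0 subr0.
  have nablaD a b y : nabla (a + b) y = nabla a y + nabla b y.
    apply: (inner_inj (ip := ip)) => Z.
    have SD : S (a + b) = S a + S b by exact: linearD.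
    rewrite /nabla !nablaE SD !innerE; ring.
  by elim: (s) => [|e r IH]; rewrite ?big_nil ?nabla0 // !big_cons nablaD IH.
rewrite /rough_laplacian linear_sum -sumrB (eq_bigr _ (fun e _ => term e)).
rewrite sumrB -!scaler_sumr sumrB -linear_sum big_split -linear_sum /=.
rewrite !sum_nabla_J_nabla !nsum [J (_ + _)]linearD [J (_ *: _)]linearZ /=.
by apply: (inner_inj (ip := ip)) => Z; rewrite !innerE; ring.
Qed.

End HarmonicEquation.

(** * Symmetric and skew parts of an endomorphism *)

Section SymmetricSkew.
Variables (R : realType) (V : vectType R) (ip : {inner V}) (f : 'End(V)).

Lemma sym_partE x y : ip (sym_part ip f x) y = 2^-1 * (ip (f x) y + ip x (f y)).
Proof.
rewrite /sym_part scale_lfunE add_lfunE innerZl innerDl.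
by rewrite (innerC _ (adjoint _ _ _)) adjointE (innerC _ x).
Qed.

Lemma skew_partE x y : ip (skew_part ip f x) y = 2^-1 * (ip (f x) y - ip x (f y)).
Proof.
rewrite /skew_part scale_lfunE add_lfunE opp_lfunE innerZl innerDl innerNl.
by rewrite (innerC _ (adjoint _ _ _)) adjointE (innerC _ x).
Qed.

Lemma sym_part_sym x y : ip (sym_part ip f x) y = ip x (sym_part ip f y).
Proof.
rewrite sym_partE (innerC ip x (sym_part _ _ _)) sym_partE addrC.
by rewrite (innerC ip x) (innerC ip y).
Qed.

Lemma skew_part_skew x y : ip (skew_part ip f x) y = - ip x (skew_part ip f y).
Proof.
rewrite skew_partE (innerC ip x (skew_part _ _ _)) skew_partE -mulrN opprB.
by rewrite (innerC ip x) (innerC ip y).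
Qed.

End SymmetricSkew.

(** * The Levi-Civita connection of an almost abelian Lie algebra *)

Section AlmostAbelianConnection.
Variables (R : realType) (g : vectType R) (br : {bilinear g -> g -> g}).
Variables (ip : {inner g}) (u : {vspace g}) (e0 : g).
Hypothesis br_alt : forall x, br x x = 0.
Hypothesis u_codim : codim_one u.
Hypothesis u_ideal : abelian_ideal br u.
Hypothesis e0_unit : ip e0 e0 = 1.
Hypothesis e0_orth : forall x, x \in u -> ip e0 x = 0.

Definition orth_proj (z : g) : g := z - ip e0 z *: e0.

Lemma orth_proj_is_linear : linear orth_proj.
Proof.
move=> a x y; apply: (inner_inj (ip := ip)) => z.
by rewrite /orth_proj !innerE; ring.
Qed.

HB.instance Definition _ :=
  GRing.isLinear.Build R g g _ orth_proj orth_proj_is_linear.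

(** As [e0] is not in [u] and [u] has codimension one, the line of [e0] and [u] span everything; the
    projection keeps the [u] component. *)
Lemma mem_orth_proj z : orth_proj z \in u.
Proof.
have e0u : e0 \notin u.
  by apply/negP => /e0_orth/eqP; rewrite e0_unit oner_eq0.
have cap0 : (<[e0]> :&: u)%VS = 0%VS.
  apply/eqP; rewrite -subv0; apply/subvP => x /memv_capP[/vlineP[a ->]] au.
  move: (e0_orth au); rewrite innerZr e0_unit mulr1 => ->.
  by rewrite scale0r mem0v.
have e0N0 : e0 != 0 by apply: contraNneq e0u => ->; rewrite mem0v.
have full : (<[e0]> + u)%VS = fullv.
  apply/eqP; rewrite eqEdim subvf /= dimv_disjoint_sum // dim_vline e0N0.
  by rewrite -u_codim.
have : z \in (<[e0]> + u)%VS by rewrite full memvf.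
case/memv_addP => _ /vlineP[a ->] [y yu ->]; rewrite /orth_proj !innerE.
by rewrite e0_unit e0_orth // mulr1 addr0 addrAC subrr add0r.
Qed.

Lemma br_anti x y : br x y = - br y x.
Proof.
apply/eqP; rewrite -addr_eq0; apply/eqP.
by have := br_alt (x + y); rewrite linearDl !linearDr /= !br_alt add0r addr0.
Qed.

Lemma br_orth_proj X : br e0 (orth_proj X) = br e0 X.
Proof. by rewrite /orth_proj linearBr linearZr_LR /= br_alt scaler0 subr0. Qed.

(** Split both arguments along R e0 + u: as [u] is abelian, only the brackets of [e0] with [u]
    survive. *)
Lemma almost_abelian_br X Y :
  br X Y = ip e0 X *: br e0 Y - ip e0 Y *: br e0 X.
Proof.
have eE Z : Z = ip e0 Z *: e0 + orth_proj Z by rewrite /orth_proj addrC subrK.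
have [_ u_abelian] := u_ideal.
have /= := br_orth_proj X; have /= := mem_orth_proj X; have := eE X.
have /= := br_orth_proj Y; have /= := mem_orth_proj Y; have := eE Y.
move: (orth_proj X) (orth_proj Y) => x y eY yu <- eX xu <-.
transitivity (ip e0 X *: (ip e0 Y *: br e0 e0 + br e0 y)
              + (ip e0 Y *: br x e0 + br x y)).
  by rewrite {1}eX {1}eY linearDl linearZl_LR !linearDr !linearZr_LR.
rewrite br_alt (u_abelian x y) // (br_anti x e0).
by rewrite scaler0 add0r addr0 scalerN.
Qed.

Lemma br_e0_u X : br e0 X \in u.
Proof. by rewrite -br_orth_proj; apply: u_ideal.1 _ _ (mem_orth_proj X). Qed.

(** [ad e0] on the whole algebra. It kills [e0] and has image in [u], so it extends [L] by zero, and
    its symmetric and skew parts extend those of [L]. *)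
Let M := linfun (br e0).

(** With every bracket written through [ad e0], the six terms of the Koszul formula regroup into
    symmetric and skew parts. *)
Lemma almost_abelian_nabla X Y : levi_civita br ip X Y =
  ip e0 X *: skew_part ip M Y + ip (sym_part ip M X) Y *: e0
    - ip e0 Y *: sym_part ip M X.
Proof.
have two_neq0 : (2 : R) != 0 by rewrite pnatr_eq0.
apply: (inner_inj (ip := ip)) => Z; apply: (mulfI two_neq0).
rewrite koszul (almost_abelian_br X Y) (almost_abelian_br Y Z) (almost_abelian_br Z X).
rewrite !innerE !sym_partE skew_partE !lfunE /=.
rewrite (innerC ip Y (br _ _)) (innerC ip X (br e0 Y)) (innerC ip X (br e0 Z)).
by field.
Qed.

Lemma sym_part_e0 : sym_part ip M e0 = 0.
Proof.
apply: (inner_inj (ip := ip)) => Z.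
by rewrite sym_partE !lfunE /= br_alt inner0l e0_orth ?br_e0_u // addr0 mulr0.
Qed.

Lemma skew_part_e0 : skew_part ip M e0 = 0.
Proof.
apply: (inner_inj (ip := ip)) => Z.
by rewrite skew_partE !lfunE /= br_alt inner0l e0_orth ?br_e0_u // subr0 mulr0.
Qed.

(** The trace formula is applied to the inclusion of [u] and the orthogonal projection onto it. The
    projection changes no term, since [ad e0] kills [e0] and maps into [u]. *)
Lemma lfun_tr_sym_part (s : seq g) (L : 'End(subvs_of u)) :
    orthonormal_basis ip s -> (forall x, vsval (L x) = br e0 (vsval x)) ->
  lfun_tr (sym_part (sub_ip ip (U:=u)) L) =
  \sum_(e <- s) ip e (sym_part ip M e).
Proof.
move=> s_basis hL.
have iK : cancel (@vsval _ _ u) (vsproj u \o orth_proj).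
  move=> x; apply: val_inj; rewrite /= /orth_proj e0_orth ?subvsP //.
  by rewrite scale0r subr0 vsprojK ?subvsP.
rewrite (lfun_tr_orthonormal s_basis _ iK); apply: eq_bigr => e _.
rewrite /=; have : vsval (vsproj u (orth_proj e)) = orth_proj e.
  by rewrite vsprojK ?mem_orth_proj.
move: (vsproj u _) => p pE.
have -> : ip e (vsval (sym_part (sub_ip ip (U:=u)) L p)) =
    sub_ip ip (sym_part (sub_ip ip (U:=u)) L p) p.
  rewrite /sub_ip pE /orth_proj !innerE (innerC ip _ e0) (e0_orth (subvsP _)).
  by rewrite mulr0 oppr0 addr0 innerC.
rewrite sym_partE /= /sub_ip !hL pE br_orth_proj.
rewrite [RHS]innerC sym_partE !lfunE /= (innerC ip _ (br _ _)) (innerC ip e).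
have -> // : ip (br e0 e) (orth_proj e) = ip (br e0 e) e.
rewrite innerDr innerNr innerZr (innerC ip _ e0) (e0_orth (br_e0_u _)).
by rewrite mulr0 subr0.
Qed.

End AlmostAbelianConnection.

(** * The commutator, halved, as a linear operator *)

Section HarmonicDefect.
Variables (R : realType) (g : vectType R) (ip : {inner g}).
Variables (J A S : 'End(g)) (e0 : g) (tr : R).

(** The operator [C] of the overview, with Tr S replaced by a free scalar [tr]. *)
Definition harmonic_defect W : g :=
  A (J (A (J W))) - J (A (J (A W)))
  + (second_fundamental_sq ip J S e0 (J W) - J (second_fundamental_sq ip J S e0 W))
  - tr *: (A W + J (A (J W))).

Lemma harmonic_defect_is_linear : linear harmonic_defect.
Proof.
have lin (f : 'End(g)) a x y : f (a *: x + y) = a *: f x + f y by exact: linearP.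
move=> a x y; apply: (inner_inj (ip := ip)) => Z.
have PE : {morph (second_fundamental_sq ip J S e0) : x y / a *: x + y}.
  move=> x' y'; apply: (inner_inj (ip := ip)) => Z'.
  by rewrite /second_fundamental_sq !lin !innerE; ring.
by rewrite /harmonic_defect !(lin, PE) !innerE; ring.
Qed.

HB.instance Definition _ :=
  GRing.isLinear.Build R g g _ harmonic_defect harmonic_defect_is_linear.

End HarmonicDefect.

(** * The orthogonal splitting g = R e0 + R e1 + a *)

Section AdaptedSplitting.
Variables (R : realType) (g : vectType R) (ip : {inner g}) (J : 'End(g)).
Variables (u : {vspace g}) (e0 : g).
Hypothesis JJ : forall x, J (J x) = - x.
Hypothesis J_isom : forall x y, ip (J x) (J y) = ip x y.
Hypothesis u_codim : codim_one u.
Hypothesis e0_unit : ip e0 e0 = 1.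
Hypothesis e0_orth : forall x, x \in u -> ip e0 x = 0.
Local Notation a := (J_inv_part J u).
Local Notation e1 := (J e0).

Lemma e0_orth_J_inv_part x : x \in a -> ip e0 x = 0.
Proof. by rewrite memv_cap => /andP[/e0_orth]. Qed.

Lemma e1_orth_J_inv_part x : x \in a -> ip e1 x = 0.
Proof.
rewrite memv_cap => /andP[_ /memv_imgP[y yu ->]].
by rewrite J_isom e0_orth.
Qed.

Lemma adapted_split (z : g) :
  {x : subvs_of a | z = ip e0 z *: e0 + (ip e1 z *: e1 + vsval x)}.
Proof.
have e1u : e1 \in u.
  have := mem_orth_proj u_codim e0_unit e0_orth e1.
  by rewrite /orth_proj (inner_Jr JJ J_isom) scale0r subr0.
pose x := orth_proj ip e0 z - ip e1 z *: e1.
have xu : x \in u.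
  by rewrite rpredB ?rpredZ // (mem_orth_proj u_codim e0_unit e0_orth).
(* Since [x] is orthogonal to [e1], [J x] is orthogonal to [e0], hence in [u]; then [x] = J (- J x)
   also lies in J u. *)
have Jxu : - J x \in u.
  have <- : orth_proj ip e0 (- J x) = - J x.
    rewrite /orth_proj (_ : ip e0 _ = 0) ?scale0r ?subr0 //.
    rewrite innerNr -(J_skew JJ J_isom) /x /orth_proj !innerE.
    by rewrite J_isom e0_unit (innerC ip e1 e0) (inner_Jr JJ J_isom); ring.
  exact: (mem_orth_proj u_codim e0_unit e0_orth).
have xa : x \in a.
  rewrite memv_cap xu /=; apply/memv_imgP; exists (- J x) => //.
  by rewrite [J (- _)]linearN /= JJ opprK.
exists (Subvs xa); rewrite /= /x /orth_proj.
by apply: (inner_inj (ip := ip)) => y; rewrite !innerE; ring.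
Qed.

End AdaptedSplitting.

(* Specialised because the generic [linearD] also matches inside the linear
   forms [ip x], and [!linearN] loops on [-%R] itself. *)
Section LinearRewriting.
Variable R : realType.

Lemma vsvalD (g : vectType R) (U : {vspace g}) (x y : subvs_of U) :
  vsval (x + y) = vsval x + vsval y.
Proof. exact: linearD. Qed.

Lemma vsvalN (g : vectType R) (U : {vspace g}) (x : subvs_of U) :
  vsval (- x) = - vsval x.
Proof. exact: linearN. Qed.

Lemma vsvalZ (g : vectType R) (U : {vspace g}) c (x : subvs_of U) :
  vsval (c *: x) = c *: vsval x.
Proof. exact: linearZ. Qed.

Lemma lfunD (U V : vectType R) (f : 'Hom(U, V)) x y : f (x + y) = f x + f y.
Proof. exact: linearD. Qed.

Lemma lfunN (U V : vectType R) (f : 'Hom(U, V)) x : f (- x) = - f x.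
Proof. exact: linearN. Qed.

Lemma lfunZ (U V : vectType R) (f : 'Hom(U, V)) c x : f (c *: x) = c *: f x.
Proof. exact: linearZ. Qed.

Lemma lfun0 (U V : vectType R) (f : 'Hom(U, V)) : f 0 = 0.
Proof. exact: linear0. Qed.

End LinearRewriting.

(** * Blocks of [S], [A] and [C] in the adapted splitting *)

Section AdaptedBlocks.
Variables (R : realType) (g : vectType R) (br : {bilinear g -> g -> g}).
Variables (ip : {inner g}) (J : 'End(g)) (u : {vspace g}) (e0 : g).
Hypothesis br_alt : forall x, br x x = 0.
Hypothesis u_codim : codim_one u.
Hypothesis u_ideal : abelian_ideal br u.
Hypothesis JJ : forall x, J (J x) = - x.
Hypothesis J_isom : forall x y, ip (J x) (J y) = ip x y.
Hypothesis e0_unit : ip e0 e0 = 1.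
Hypothesis e0_orth : forall x, x \in u -> ip e0 x = 0.
Local Notation a := (J_inv_part J u).
Local Notation e1 := (J e0).
Local Notation ipa := (sub_ip ip (U:=a)).
Local Notation M := (linfun (br e0)).

Variables (J' : 'End(subvs_of a)) (mu : R) (v0 w0 : subvs_of a).
Variable D : 'End(subvs_of a).
Hypothesis J'E : forall x, vsval (J' x) = J (vsval x).
Hypothesis br_e1 : br e0 e1 = mu *: e1 + vsval v0.
Hypothesis br_a : forall x : subvs_of a,
  br e0 (vsval x) = ip (vsval w0) (vsval x) *: e1 + vsval (D x).

Variables (gamma rho : subvs_of a) (Ds Da : 'End(subvs_of a)).
Hypothesis gammaE : gamma = 2^-1 *: (v0 + w0).
Hypothesis rhoE : rho = 2^-1 *: (v0 - w0).
Hypothesis DsE : Ds = sym_part ipa D.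
Hypothesis DaE : Da = skew_part ipa D.

Lemma ip_e0_a (x : subvs_of a) : ip e0 (vsval x) = 0.
Proof. exact: e0_orth_J_inv_part (subvsP x). Qed.

Lemma ip_e1_a (x : subvs_of a) : ip e1 (vsval x) = 0.
Proof. exact: (e1_orth_J_inv_part J_isom e0_orth (subvsP x)). Qed.

Lemma ip_a_e0 (x : subvs_of a) : ip (vsval x) e0 = 0.
Proof. by rewrite innerC ip_e0_a. Qed.

Lemma ip_a_e1 (x : subvs_of a) : ip (vsval x) e1 = 0.
Proof. by rewrite innerC ip_e1_a. Qed.

Lemma ip_e0_e1 : ip e0 e1 = 0.
Proof. exact: (inner_Jr JJ J_isom). Qed.

Lemma ip_e1_e0 : ip e1 e0 = 0.
Proof. by rewrite innerC ip_e0_e1. Qed.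

Lemma ip_e1_e1 : ip e1 e1 = 1.
Proof. by rewrite J_isom. Qed.

Let frameE := (ip_e0_a, ip_e1_a, ip_a_e0, ip_a_e1, ip_e0_e1, ip_e1_e0,
  ip_e1_e1, e0_unit).

Lemma eq_adapted (x y : g) :
  ip x e0 = ip y e0 -> ip x e1 = ip y e1 ->
  (forall z : subvs_of a, ip x (vsval z) = ip y (vsval z)) -> x = y.
Proof.
move=> xy0 xy1 xya; apply: (inner_inj (ip := ip)) => z.
have [w ->] := adapted_split JJ J_isom u_codim e0_unit e0_orth z.
by rewrite !innerE xy0 xy1 xya.
Qed.

Let valE := (vsvalD, vsvalN, vsvalZ).

(** Transposing [L] swaps [v0] and [w0]: [S] has [gamma] in both off-diagonal blocks, while [A] has
    [rho] below the diagonal and minus its transpose above. *)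
Lemma sym_part_e1 : sym_part ip M e1 = mu *: e1 + vsval gamma.
Proof.
apply: eq_adapted => [||z]; rewrite sym_partE !lfunE /= ?br_alt br_e1 ?br_a.
- by rewrite gammaE ?valE !innerE !frameE; ring.
- by rewrite gammaE ?valE !innerE !frameE; field.
by rewrite gammaE ?valE !innerE !frameE; field.
Qed.

Lemma skew_part_e1 : skew_part ip M e1 = vsval rho.
Proof.
apply: eq_adapted => [||z]; rewrite skew_partE !lfunE /= ?br_alt br_e1 ?br_a.
- by rewrite rhoE ?valE !innerE !frameE; ring.
- by rewrite rhoE ?valE !innerE !frameE; ring.
by rewrite rhoE ?valE !innerE !frameE; ring.
Qed.

Lemma ip_Ds x y : ip (vsval (Ds x)) (vsval y) =
  2^-1 * (ip (vsval (D x)) (vsval y) + ip (vsval x) (vsval (D y))).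
Proof. by have := sym_partE ipa D x y; rewrite -DsE. Qed.

Lemma ip_Da x y : ip (vsval (Da x)) (vsval y) =
  2^-1 * (ip (vsval (D x)) (vsval y) - ip (vsval x) (vsval (D y))).
Proof. by have := skew_partE ipa D x y; rewrite -DaE. Qed.

Lemma sym_part_a x :
  sym_part ip M (vsval x) = ip (vsval gamma) (vsval x) *: e1 + vsval (Ds x).
Proof.
apply: eq_adapted => [||z]; rewrite sym_partE !lfunE /= ?br_alt ?br_e1 !br_a.
- by rewrite !innerE !frameE; ring.
- rewrite gammaE ?valE !innerE !frameE.
  by rewrite (innerC ip (vsval x)); ring.
by rewrite !innerE !frameE ip_Ds; ring.
Qed.

Lemma skew_part_a x :
  skew_part ip M (vsval x) = - ip (vsval rho) (vsval x) *: e1 + vsval (Da x).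
Proof.
apply: eq_adapted => [||z]; rewrite skew_partE !lfunE /= ?br_alt ?br_e1 !br_a.
- by rewrite !innerE !frameE; ring.
- rewrite rhoE ?valE !innerE !frameE.
  by rewrite (innerC ip (vsval x)); ring.
by rewrite !innerE !frameE ip_Da; ring.
Qed.

Let linE := (lfunD, lfunN, lfunZ).

Variable tr : R.
Local Notation A := (skew_part ip M).
Local Notation S := (sym_part ip M).
Local Notation defect := (harmonic_defect ip J A S e0 tr).

(** As J^2 = -1, every [K,J] anticommutes with [J], and so does [K,J] J. The summands of [C] are
    [A J A, J], [P, J] and a multiple of A + J A J = -[A,J] J. *)
Lemma harmonic_defect_J W : defect (J W) = - J (defect W).
Proof.
rewrite /harmonic_defect /second_fundamental_sq !linE !JJ !linE.
by apply: (inner_inj (ip := ip)) => Z; rewrite !innerE; ring.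
Qed.

Definition defect1 : subvs_of a :=
  mu *: gamma + Ds gamma - tr *: rho - J' (Da (J' rho)).

Definition defect2 : 'End(subvs_of a) :=
  ((Da \o J' \o Da \o J') - (J' \o Da \o J' \o Da)
     + tr *: (lfun_comm Da J' \o J'))%VF.

Lemma J'J' x : J' (J' x) = - x.
Proof. by apply: val_inj; rewrite /= !J'E JJ. Qed.

Let Ae0 : A e0 = 0 := skew_part_e0 br_alt u_codim u_ideal e0_unit e0_orth.
Let Se0 : S e0 = 0 := sym_part_e0 br_alt u_codim u_ideal e0_unit e0_orth.

(** J e1 = -e0 is killed by [A] and [S]. The [e1] component of S^2 e1 is |S e1|^2, which cancels
    against - J P e1, so only a vector of [a] is left. *)
Lemma harmonic_defect_e1 : defect e1 = vsval defect1.
Proof.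
have rhoJ : ip (vsval rho) (vsval (J' rho)) = 0.
  by rewrite J'E (inner_Jr JJ J_isom).
rewrite /harmonic_defect /second_fundamental_sq /defect1 !JJ !linE Ae0 Se0.
rewrite skew_part_e1 -J'E skew_part_a rhoJ sym_part_e1.
rewrite ip_e0_e1 !oppr0 !scale0r add0r !lfun0 -J'E inner0l scale0r !linE.
rewrite sym_part_e1 sym_part_a !valE.
by apply: eq_adapted => [||z]; rewrite !innerE !frameE; ring.
Qed.

(** The first two components reflect that [C] is skew and anticommutes with [J], so that C e1
    determines them; they are checked here by expansion. On [a], [P,J] takes values in the plane of
    [e0] and [e1], so it does not enter [defect2]. *)
Lemma harmonic_defect_a x : defect (vsval x) =
  ip (vsval defect1) (vsval (J' x)) *: e0
  - ip (vsval defect1) (vsval x) *: e1 + vsval (defect2 x).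
Proof.
have J'_skew y z : ip (vsval (J' y)) (vsval z) = - ip (vsval y) (vsval (J' z)).
  by rewrite !J'E (J_skew JJ J_isom).
have Da_skew y z : ip (vsval (Da y)) (vsval z) = - ip (vsval y) (vsval (Da z)).
  by have := skew_part_skew ipa D y z; rewrite -DaE.
have Ds_sym y z : ip (vsval (Ds y)) (vsval z) = ip (vsval y) (vsval (Ds z)).
  by have := sym_part_sym ipa D y z; rewrite -DsE.
(* Since J'^2 = -1, [Da,J'] J' = -(Da + J' Da J'), the shape of the trace term in [C]. *)
have -> : defect2 x = Da (J' (Da (J' x))) - J' (Da (J' (Da x)))
    - tr *: (Da x + J' (Da (J' x))).
  rewrite /defect2 /lfun_comm !(add_lfunE, opp_lfunE, scale_lfunE, comp_lfunE).
  by rewrite J'J' lfunN -opprD scalerN.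
(* All operators are moved onto [y], matching the pairings produced by expanding [C]. *)
have ip1 y : ip (vsval defect1) (vsval y) = mu * ip (vsval gamma) (vsval y)
    + ip (vsval gamma) (vsval (Ds y)) - tr * ip (vsval rho) (vsval y)
    + ip (vsval rho) (vsval (J' (Da (J' y)))).
  by rewrite /defect1 !valE !innerE Ds_sym J'_skew Da_skew J'_skew !opprK.
rewrite !ip1 J'J' !linE.
rewrite /harmonic_defect /second_fundamental_sq -!J'E !frameE !skew_part_a !linE.
rewrite !JJ ?linE Ae0 -!J'E !skew_part_a sym_part_e1 !sym_part_a ?linE -!J'E !JJ.
rewrite !lfun0 !valE.
apply: eq_adapted => [||z]; rewrite !innerE !frameE.
- by rewrite (innerC ip (vsval (Ds _))); ring.
- by rewrite (innerC ip (vsval (Ds x))); ring.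
by ring.
Qed.

Lemma harmonic_defect_eq0 :
  (forall W, defect W = 0) <-> defect1 = 0 /\ defect2 = 0.
Proof.
split=> [defect0|[d1 d2] W].
  have d1 : defect1 = 0.
    by apply: val_inj; rewrite [LHS](esym harmonic_defect_e1) defect0.
  split=> //; apply/lfunP => x; apply: val_inj.
  have := harmonic_defect_a x; rewrite defect0 d1 !inner0l !scale0r subr0 add0r.
  by move=> d2x; rewrite zero_lfunE; exact: esym d2x.
have de1 : defect e1 = 0 by rewrite harmonic_defect_e1 d1.
(* Anticommutation gives J (C e0) = - C e1 = 0, and [J] is injective. *)
have de0 : defect e0 = 0.
  have Jde0 : J (defect e0) = 0 by rewrite -[J _]opprK -harmonic_defect_J de1 oppr0.
  by rewrite -[LHS]opprK -(JJ (defect e0)) Jde0 lfun0 oppr0.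
have [x ->] := adapted_split JJ J_isom u_codim e0_unit e0_orth W.
rewrite !linearD !linearZ /= de0 de1 harmonic_defect_a d1 d2 zero_lfunE.
by rewrite !(inner0l, scale0r, scaler0, add0r, addr0, oppr0).
Qed.

End AdaptedBlocks.

(** * Harmonicity of [J] in terms of the blocks of [L] *)

Theorem theorem3p3 (R : realType) (n : nat) (g : vectType R)
    (br : {bilinear g -> g -> g}) (ip : {inner g}) (J : 'End(g))
    (u : {vspace g}) (e0 : g) (f : seq g)
    (hdim : \dim {:g} = (2 * n)%N)
    (hbr : is_lie_bracket br)
    (hJ : almost_hermitian ip J)
    (hcodim : codim_one u)
    (hideal : abelian_ideal br u)
    (he0_unit : ip e0 e0 = 1)
    (he0_orth : forall x, x \in u -> ip e0 x = 0)
    (hf : orthonormal_basis ip f)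
    (L : 'End(subvs_of u))
    (hL : forall x, vsval (L x) = br e0 (vsval x))
    (J' : 'End(subvs_of (J_inv_part J u)))
    (hJ' : forall x, vsval (J' x) = J (vsval x))
    (mu : R) (v0 w0 : subvs_of (J_inv_part J u))
    (D : 'End(subvs_of (J_inv_part J u)))
    (hLe1 : br e0 (J e0) = mu *: J e0 + vsval v0)
    (hLa : forall x : subvs_of (J_inv_part J u),
       br e0 (vsval x) = ip (vsval w0) (vsval x) *: J e0 + vsval (D x)) :
  let S := sym_part (sub_ip ip (U:=u)) L in
  let Ds := sym_part (sub_ip ip (U:=J_inv_part J u)) D in
  let Da := skew_part (sub_ip ip (U:=J_inv_part J u)) D in
  let gamma := 2^-1 *: (v0 + w0) in
  let rho := 2^-1 *: (v0 - w0) in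
  harmonic br ip f J <->
  mu *: gamma + Ds gamma - lfun_tr S *: rho - J' (Da (J' rho)) = 0 /\
  ((Da \o J' \o Da \o J') - (J' \o Da \o J' \o Da)
     + lfun_tr S *: (lfun_comm Da J' \o J'))%VF = 0.
Proof.
move=> S Ds Da gamma rho.
have br_alt := hbr.1.
have JJ x : J (J x) = - x.
  by have /lfunP/(_ x) := hJ.1; rewrite comp_lfunE opp_lfunE id_lfunE.
have J_isom x y : ip (J x) (J y) = ip x y by exact: hJ.2.
have trE := lfun_tr_sym_part br_alt hcodim hideal he0_unit he0_orth hf hL.
have defectE W : J (rough_laplacian br ip f J W) - rough_laplacian br ip f J (J W)
    = 2 *: harmonic_defect ip J (skew_part ip (linfun (br e0)))
        (sym_part ip (linfun (br e0))) e0 (lfun_tr S) W.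
  rewrite /S trE; apply: laplacian_commutator => //.
  - exact: sym_part_sym.
  - exact: sym_part_e0 br_alt hcodim hideal he0_unit he0_orth.
  - exact: skew_part_e0 br_alt hcodim hideal he0_unit he0_orth.
  - exact: almost_abelian_nabla br_alt hcodim hideal he0_unit he0_orth.
have eq0 := harmonic_defect_eq0 br_alt hcodim hideal JJ J_isom he0_unit he0_orth
  hJ' hLe1 hLa (erefl gamma) (erefl rho) (erefl Ds) (erefl Da) (lfun_tr S).
apply: iff_trans eq0; split=> [harm W|defect0 W]; last first.
  by rewrite defectE defect0 scaler0.
(* The factor 2 is nonzero, so the commutator vanishes only if [C] does. *)
by have /eqP := harm W; rewrite defectE scaler_eq0 pnatr_eq0 => /eqP.
Qed.
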